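(* Assume that a pair of sliding vector fields exists at $(x,0,0)\in\Lambda$ (i.e. $\tilde F_x$ has exactly two zeros in $(-1,1)^2$). Then the stability of one of the sliding vector fields is of saddle type and the stability of the other sliding vector field is of node/focus type.
   Context: Setting. Let $\mathcal U\subset\mathbb R^3$ with coordinates $(x,y,z)$, $\mathcal I$ an interval, $\Lambda=\{(x,0,0):x\in\mathcal I\}$, $\mathcal Q_1=\{y\ge0,z\ge0\}$, $\mathcal Q_2=\{y\le0,z\ge0\}$, $\mathcal Q_3=\{y\le0,z\le0\}$, $\mathcal Q_4=\{y\ge0,z\le0\}$. The piecewise smooth system is $(\dot x,\dot y,\dot z)^T=X_i$ on $\mathcal Q_i$ with smooth $X_i=(\alpha_i,\beta_i,\gamma_i)^T$; standing assumption: $\alpha_i,\beta_i,\gamma_i$ depend only on $x$. Put $\tilde X_i=(\beta_i,\gamma_i)^T$. For $x\in\mathcal I$ and $(\psi,\phi)\in(-1,1)^2$ let $$\tilde F_x(\psi,\phi)=\tfrac12\Big(\tfrac{\tilde X_1}{2}(1+\phi)+\tfrac{\tilde X_4}{2}(1-\phi)\Big)(1+\psi)+\tfrac12\Big(\tfrac{\tilde X_2}{2}(1+\phi)+\tfrac{\tilde X_3}{2}(1-\phi)\Big)(1-\psi).$$ Sliding. Sliding vector fields at $(x,0,0)$ correspond to zeros $(\psi_*,\phi_* )\in(-1,1)^2$ of $\tilde F_x$: with $\sigma_\psi=(1+\psi_* )/2$, $\sigma_\phi=(1+\phi_* )/2$, the sliding vector field has $x$-component $\sigma_\psi\sigma_\phi\alpha_1+(1-\sigma_\psi)\sigma_\phi\alpha_2+(1-\sigma_\psi)(1-\sigma_\phi)\alpha_3+\sigma_\psi(1-\sigma_\phi)\alpha_4$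 and vanishing $y,z$-components. Stability. Let $\psi,\phi:\mathbb R\to[-1,1]$ be regularization functions: smooth, with positive derivative wherever the value lies in $(-1,1)$, tending to $\pm1$ at $\pm\infty$ (and with $r\mapsto\psi(r^{-1}),\phi(r^{-1})$ extending smoothly to $r=0$ from either side). For a zero $(\psi_*,\phi_* )$ put $\hat y_*=\psi^{-1}(\psi_* )$, $\hat z_*=\phi^{-1}(\phi_* )$ and $\mathbf J=\mathbf D\tilde F_x(\psi_*,\phi_* )\,\mathrm{diag}(\psi'(\hat y_* ),\phi'(\hat z_* ))$, the Jacobian at $(\hat y_*,\hat z_* )$ of the layer problem $(\hat y',\hat z')^T=\tilde F_x(\psi(\hat y),\phi(\hat z))$. The stability is of saddle type if $\det\mathbf J<0$ (equivalently $\det\mathbf D\tilde F_x(\psi_*,\phi_* )<0$), and of node/focus type (also called node/focus/center type) if $\det\mathbf J>0$ (equivalently $\det\mathbf D\tilde F_x(\psi_*,\phi_* )>0$). *)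

(* Defs.v *)
From HB Require Import structures.
From mathcomp Require Export all_boot all_order all_algebra.
From mathcomp Require Export all_classical all_reals all_analysis.
Export numFieldNormedType.Exports.

Set Implicit Arguments.
Unset Strict Implicit.
Unset Printing Implicit Defensive.
Import Order.TTheory GRing.Theory Num.Theory.
Local Open Scope classical_set_scope.
Local Open Scope ring_scope.

(* Smoothness (C^oo) on a set A that need not be open: as usual, f is smooth on
   A if it coincides on A with a function that is smooth on an open superset. *)
Definition smooth_on (R : realType) (A : set R) (f : R -> R) : Prop :=
  exists (O : set R) (g : R -> R),
    [/\ open O, A `<=` O, {in A, f =1 g} &
        forall (n : nat) (t : R), O t -> derivable (derive1n n g) t 1].

(* Q1 = {y >= 0, z >= 0}, Q2 = {y <= 0, z >= 0},
   Q3 = {y <= 0, z <= 0}, Q4 = {y >= 0, z <= 0}. *)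
Inductive quadrant := Q1 | Q2 | Q3 | Q4.

(* The piecewise smooth system equal to X_q = (alpha q, beta q, gamma q) on the
   quadrant q, whose components depend on the coordinate x only; it is studied
   along Lambda = {(x, 0, 0) | x in pws_itv}. *)
Record pws_system (R : realType) := PWSSystem {
  pws_itv : set R ;
  alpha : quadrant -> R -> R ;
  beta : quadrant -> R -> R ;
  gamma : quadrant -> R -> R ;
  pws_itvP : is_interval pws_itv ;
  alpha_smooth : forall q, smooth_on pws_itv (alpha q) ;
  beta_smooth : forall q, smooth_on pws_itv (beta q) ;
  gamma_smooth : forall q, smooth_on pws_itv (gamma q) }.

Definition row2 (R : realType) (a b : R) : 'rV[R]_2 :=
  \row_(j < 2) (if j == 0 then a else b).

Definition row3 (R : realType) (a b c : R) : 'rV[R]_3 :=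
  \row_(j < 3) (if j == 0 then a else if j == 1 then b else c).

Section Sliding.
Variables (R : realType) (S : pws_system R).

Definition Xtilde (q : quadrant) (x : R) : 'rV[R]_2 :=
  row2 (beta S q x) (gamma S q x).

(* The argument is the row vector (psi, phi). *)
Definition Ftilde (x : R) (p : 'rV[R]_2) : 'rV[R]_2 :=
  let psi := p 0 0 in let phi := p 0 1 in
  2^-1 *: ((1 + psi) *: ((1 + phi) *: (2^-1 *: Xtilde Q1 x) +
                         (1 - phi) *: (2^-1 *: Xtilde Q4 x))) +
  2^-1 *: ((1 - psi) *: ((1 + phi) *: (2^-1 *: Xtilde Q2 x) +
                         (1 - phi) *: (2^-1 *: Xtilde Q3 x))).

(* The zeros of Ftilde x in the open square; each of them labels one sliding
   vector field at (x, 0, 0), namely sliding_vector_field x p below. *)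
Definition sliding_zeros (x : R) : set 'rV[R]_2 :=
  [set p : 'rV[R]_2 | (-1 < p 0 0 < 1) /\ (-1 < p 0 1 < 1) /\ Ftilde x p = 0].

Definition sliding_vector_field (x : R) (p : 'rV[R]_2) : 'rV[R]_3 :=
  let spsi := (1 + p 0 0) / 2 in let sphi := (1 + p 0 1) / 2 in
  row3 (spsi * sphi * alpha S Q1 x
        + (1 - spsi) * sphi * alpha S Q2 x
        + (1 - spsi) * (1 - sphi) * alpha S Q3 x
        + spsi * (1 - sphi) * alpha S Q4 x) 0 0.

(* At (x, 0, 0) there are exactly two sliding vector fields, labelled p, q. *)
Definition sliding_pair (x : R) (p q : 'rV[R]_2) : Prop :=
  p <> q /\ sliding_zeros x = [set p; q].

End Sliding.

Record regularization (R : realType) (psi : R -> R) : Prop := Regularization {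
  reg_range : forall r, -1 <= psi r <= 1 ;
  reg_smooth : smooth_on setT psi ;
  reg_incr : forall r, -1 < psi r < 1 -> 0 < derive1 psi r ;
  reg_pinfty : psi r @[r --> +oo] --> (1 : R) ;
  reg_ninfty : psi r @[r --> -oo] --> (-1 : R) ;
  reg_ext_right : exists g : R -> R,
    smooth_on `[0, +oo[%classic g /\ forall r : R, 0 < r -> g r = psi r^-1 ;
  reg_ext_left : exists g : R -> R,
    smooth_on `]-oo, 0]%classic g /\ forall r : R, r < 0 -> g r = psi r^-1 }.

(* psi^-1 s, for s in (-1, 1): for a regularization function psi there is
   exactly one r with psi r = s. *)
Definition reg_inv (R : realType) (psi : R -> R) (s : R) : R :=
  get [set r | psi r = s].

Section Stability.
Variables (R : realType) (S : pws_system R) (psi phi : R -> R) (x : R).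

(* The library's 'J acts on row vectors, hence the transpose. *)
Definition layer_jacobian (p : 'rV[R]_2) : 'M[R]_2 :=
  (jacobian (Ftilde S x) p)^T *m
  diag_mx (row2 (derive1 psi (reg_inv psi (p 0 0))) (derive1 phi (reg_inv phi (p 0 1)))).

Definition saddle_type (p : 'rV[R]_2) : Prop := \det (layer_jacobian p) < 0.

Definition node_focus_type (p : 'rV[R]_2) : Prop := 0 < \det (layer_jacobian p).

End Stability.

(* Main.v *)
(* Ftilde is affine in psi and in phi separately, so between two zeros its
   increment is its differential at the midpoint applied to the difference:
   det DFtilde vanishes at the midpoint. For bilinear maps this determinant is
   affine in (psi, phi), so its values at the two zeros are opposite. If they
   were 0, the two scalar equations would, near a zero, cut out a common line
   or hyperbola, giving a third zero. Finally det J is det DFtilde times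
   psi' phi' > 0. *)

Require Import Defs.
From mathcomp Require Import ring lra.
Import Order.TTheory GRing.Theory Num.Theory.
Local Open Scope classical_set_scope.
Local Open Scope ring_scope.

(** * Zeros of a pair of bilinear equations in the plane *)

(** Solving for [s] gives [s = m r / (1 - k r)], which tends to 0 with [r]. *)
Lemma hyperbola_point_near0 (F : realFieldType) (m k e : F) : 0 < e ->
  exists s r : F, [/\ `|s| < e, 0 < r < e & s = m * r + k * s * r].
Proof.
move=> e0; have m0 := normr_ge0 m; have k0 := normr_ge0 k.
have ke0 : 0 <= `|k| * e by rewrite mulr_ge0 // ltW.
(* With [r = e / D] one has [k r <= 1/4] and [|m r| <= e/4], hence [|s| <= e/3]. *)
set D := 4 * (1 + `|m| + `|k| * e); have D0 : 0 < D by rewrite /D; lra.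
have [r0 re] : 0 < e / D /\ e / D < e.
  by rewrite divr_gt0 // gtr_pMr // invf_lt1 //; split=> //; rewrite /D; lra.
set r := e / D in r0 re.
have rD : r * D = e by rewrite /r divfK // gt_eqF.
have kr : k * r <= 4^-1.
  apply: le_trans (_ : `|k| * r <= _); first by rewrite ler_pM2r // ler_norm.
  rewrite -(ler_pM2r D0) -mulrA rD /D; lra.
have mr : `|m * r| <= e / 4.
  rewrite normrM (gtr0_norm r0) -(ler_pM2r D0) -mulrA rD /D.
  have : 0 <= e * (1 + `|k| * e) by rewrite mulr_ge0 ?ltW //; lra.
  lra.
have c0 : 0 < 1 - k * r by lra.
exists (m * r / (1 - k * r)), r; split; last 2 first.
- by rewrite r0.
- by field; rewrite gt_eqF.
rewrite normrM normfV (gtr0_norm c0) ltr_pdivrMr //.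
apply: le_lt_trans mr _; rewrite ltr_pM2l //; lra.
Qed.

(* (m, 1) lies in the kernel of the differential at 0; if h k <> 0, eliminating
   d and D with the zero (h, k) makes both equations multiples of one conic. *)
Lemma bilinear_zero_near0_ker (F : realFieldType) (b d B D h k m e : F) :
  0 < e -> (h != 0) || (k != 0) ->
  b * h - b * m * k + d * h * k = 0 -> B * h - B * m * k + D * h * k = 0 ->
  exists s r : F, [/\ `|s| < e, `|r| < e, (s != 0) || (r != 0),
    (s != h) || (r != k) &
    b * s - b * m * r + d * s * r = 0 /\ B * s - B * m * r + D * s * r = 0].
Proof.
move=> e0 hk E1 E2.
have small (x : F) : x != 0 -> exists2 t, 0 < t < e & t != x.
  rewrite -normr_gt0 => x0.
  have t0 : 0 < Num.min e `|x| by rewrite lt_min e0.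
  have te : Num.min e `|x| <= e by rewrite ge_min lexx.
  have tx : Num.min e `|x| <= `|x| by rewrite ge_min lexx orbT.
  exists (Num.min e `|x| / 2); first by apply/andP; split; lra.
  apply/eqP => xE; have xx : `|x| = x by rewrite gtr0_norm // -xE divr_gt0.
  lra.
(* If [k = 0], then [b = B = 0] and the whole axis [r = 0] consists of zeros. If [h = 0], then
   [b m = B m = 0] and the axis [s = 0] does. *)
have [k0|k0] := eqVneq k 0.
  have h0 : h != 0 by move: hk; rewrite k0 eqxx orbF.
  have [s /andP[s0 se] sh] := small h h0.
  have vanish (c g : F) : c * h - c * m * k + g * h * k = 0 -> c = 0.
    rewrite k0 !mulr0 subr0 addr0 => /eqP.
    by rewrite mulf_eq0 (negPf h0) orbF => /eqP.
  exists s, 0; rewrite (gtr0_norm s0) normr0 sh (gt_eqF s0); split=> //.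
  by rewrite (vanish _ _ E1) (vanish _ _ E2); split; ring.
have [h0|h0] := eqVneq h 0.
  have [r /andP[r0 re] rk] := small k k0.
  have vanish (c g : F) : c * h - c * m * k + g * h * k = 0 -> c * m = 0.
    rewrite h0 !(mulr0, mul0r) addr0 sub0r => /eqP.
    by rewrite oppr_eq0 mulf_eq0 (negPf k0) orbF => /eqP.
  exists 0, r; rewrite (gtr0_norm r0) normr0 rk (gt_eqF r0) orbT orbT; split=> //.
  by rewrite (vanish _ _ E1) (vanish _ _ E2); split; ring.
(* The curve is [s = m r + (1/k - m/h) s r], the one of this form through [(h, k)]; the bound
   [r < |k|] keeps [r] away from [k]. *)
have e'0 : 0 < Num.min e `|k| by rewrite lt_min e0 normr_gt0.
have [s [r [se /andP[r0 re] sE]]] :=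
  hyperbola_point_near0 _ m (k^-1 - m / h) _ e'0.
have slope (c g : F) : c * h - c * m * k + g * h * k = 0 ->
    c * s - c * m * r + g * s * r = 0.
  move=> E; have -> : g = - c * (k^-1 - m / h).
    apply: (mulIf (mulf_neq0 h0 k0)); rewrite mulrA.
    have -> : g * h * k = c * m * k - c * h by lra.
    by field; rewrite h0.
  by rewrite {1}sE; ring.
move: se re; rewrite !lt_min => /andP[se _] /andP[re rk].
exists s, r; split=> //; last by split; exact: slope.
- by rewrite gtr0_norm.
- by rewrite (gt_eqF r0) orbT.
- apply/orP; right; apply/negP => /eqP rk'.
  by move: rk; rewrite -rk' gtr0_norm // ltxx.
Qed.

(** Of two dependent columns one is a multiple of the other; the sign puts [(m, 1)] or [(1, m)] into
    the kernel. *)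
Lemma det2_eq0_ker (F : fieldType) (b c B C : F) : b * C = c * B ->
  (exists m, c = - (b * m) /\ C = - (B * m)) \/
  (exists m, b = - (c * m) /\ B = - (C * m)).
Proof.
move=> E; have [b0|b0] := eqVneq b 0; last first.
  left; exists (- (c / b)); split; first by field.
  by apply: (mulfI b0); rewrite E; field.
have [c0|c0] := eqVneq c 0; last first.
  right; exists (- (b / c)); split; first by field.
  by apply: (mulfI c0); rewrite -E; field.
have [B0|B0] := eqVneq B 0.
  by right; exists 0; rewrite b0 B0; split; ring.
by left; exists (- (C / B)); rewrite b0 c0; split; field.
Qed.

(** A kernel vector [(m, 1)] is the case already treated, and [(1, m)] reduces to it by exchanging
    the two variables. *)
Lemma bilinear_zero_near0 (F : realFieldType) (b c d B C D h k e : F) :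
  0 < e -> (h != 0) || (k != 0) -> b * C = c * B ->
  b * h + c * k + d * h * k = 0 -> B * h + C * k + D * h * k = 0 ->
  exists s r : F, [/\ `|s| < e, `|r| < e, (s != 0) || (r != 0),
    (s != h) || (r != k) &
    b * s + c * r + d * s * r = 0 /\ B * s + C * r + D * s * r = 0].
Proof.
move=> e0 hk /det2_eq0_ker[[m [-> ->]]|[m [-> ->]]] E1 E2.
  have [||s [r [se re n0 nh [Z1 Z2]]]] :=
    @bilinear_zero_near0_ker _ b d B D h k m e e0 hk.
  - by rewrite -[RHS]E1; ring.
  - by rewrite -[RHS]E2; ring.
  exists s, r; split=> //; split.
  - by rewrite -[RHS]Z1; ring.
  - by rewrite -[RHS]Z2; ring.
rewrite orbC in hk.
have [||r [s [re se n0 nh [Z1 Z2]]]] :=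
  @bilinear_zero_near0_ker _ c d C D k h m e e0 hk.
- by rewrite -[RHS]E1; ring.
- by rewrite -[RHS]E2; ring.
exists s, r; split; rewrite // 1?orbC //; split.
- by rewrite -[RHS]Z1; ring.
- by rewrite -[RHS]Z2; ring.
Qed.

Lemma bilinear_det_opp (F : fieldType) (b c d B C D h k : F) :
  (h != 0) || (k != 0) ->
  b * h + c * k + d * h * k = 0 -> B * h + C * k + D * h * k = 0 ->
  (b + d * k) * (C + D * h) - (c + d * h) * (B + D * k) = - (b * C - c * B).
Proof.
move=> hk E1 E2; apply/eqP; rewrite -subr_eq0 opprK; apply/eqP.
set X := (X in X = 0).
(* [X] is twice the determinant at the midpoint of 0 and [(h, k)]. The multipliers are those of
   Cramer's rule there, doubled so that nothing is divided by 2. *)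
have hX : h * X = 0.
  transitivity ((2 * C + D * h) * (b * h + c * k + d * h * k)
                - (2 * c + d * h) * (B * h + C * k + D * h * k)).
    by rewrite /X; ring.
  by rewrite E1 E2; ring.
have kX : k * X = 0.
  transitivity ((2 * b + d * k) * (B * h + C * k + D * h * k)
                - (2 * B + D * k) * (b * h + c * k + d * h * k)).
    by rewrite /X; ring.
  by rewrite E1 E2; ring.
by case/orP: hk => n0; apply: (mulfI n0); rewrite mulr0.
Qed.

(** * Inverse values of regularization functions *)

Lemma smooth_on_setT_derivable (R : realType) (f : R -> R) (t : R) :
  smooth_on setT f -> derivable f t 1.
Proof.
move=> [U [g [_ sub fg gd]]].
have -> : f = g by apply/funext => r; apply: fg; rewrite inE.
exact: gd 0%N t (sub t I).
Qed.

(** The limits -1 and 1 enclose [s], so by the intermediate value theorem [get] chooses from a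
    nonempty set. *)
Lemma reg_invK (R : realType) (psi : R -> R) (s : R) :
  regularization psi -> -1 < s < 1 -> psi (reg_inv psi s) = s.
Proof.
move=> [_ psi_smooth _ psi_py psi_ny _ _] /andP[s_gt s_lt].
rewrite /reg_inv; apply: (@getPex _ [set r | psi r = s]) => /=.
(* The signs of [a] and [b] serve to order them. *)
have [a [psia a0]] : exists a, psi a < s /\ a < 0.
  near (ninfty_nbhs R) => a; exists a; split; near: a.
    exact: cvgr_lt psi_ny _ s_gt.
  exact: nbhs_ninfty_lt.
have [b [psib b0]] : exists b, s < psi b /\ 0 < b.
  near (pinfty_nbhs R) => b; exists b; split; near: b.
    exact: cvgr_gt psi_py _ s_lt.
  exact: nbhs_pinfty_gt.
have [|||c _ <-] := @IVT _ psi a b s; last by exists c.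
- by rewrite ltW // (lt_trans a0).
- by apply: derivable_within_continuous => t _; exact: smooth_on_setT_derivable.
- by rewrite ge_min le_max (ltW psia) (ltW psib) orbT.
Unshelve. all: by end_near. Qed.

Lemma derive_reg_inv_gt0 (R : realType) (psi : R -> R) (s : R) :
  regularization psi -> -1 < s < 1 -> 0 < derive1 psi (reg_inv psi s).
Proof.
by move=> hpsi hs; apply: (reg_incr hpsi); rewrite reg_invK.
Qed.

(** * Taylor expansion and Jacobian of [Ftilde] *)

Lemma ord2_cases (i : 'I_2) : i = 0 \/ i = 1.
Proof. by case: i => -[|[|//]] lt_i; [left|right]; apply/val_inj. Qed.

Lemma det_mx22 (R : comNzRingType) (M : 'M[R]_2) :
  \det M = M 0 0 * M 1 1 - M 0 1 * M 1 0.
Proof.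
rewrite (expand_det_row _ 0) big_ord_recl big_ord1 /cofactor !det_mx11 !mxE /=.
have -> : lift 0 0 = 1 :> 'I_2 by apply/val_inj.
have -> : lift 1 0 = 0 :> 'I_2 by apply/val_inj.
by rewrite /= expr0 expr1 mul1r mulN1r mulrN.
Qed.

Section FtildeExpansion.
Variables (R : realType) (S : pws_system R) (x : R).

Let X q := Xtilde S q x.

(** The partial derivative in psi at phi = [v]; next come the one in phi at psi = [u] and the mixed
    second derivative, which is constant. *)
Definition Ftilde_psi (v : R) : 'rV[R]_2 :=
  4^-1 *: ((1 + v) *: (X Q1 - X Q2) + (1 - v) *: (X Q4 - X Q3)).
Definition Ftilde_phi (u : R) : 'rV[R]_2 :=
  4^-1 *: ((1 + u) *: (X Q1 - X Q4) + (1 - u) *: (X Q2 - X Q3)).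
Definition Ftilde_mix : 'rV[R]_2 := 4^-1 *: (X Q1 - X Q2 - X Q4 + X Q3).

(** The Taylor expansion at [p] stops here because [Ftilde] is affine in each variable. *)
Lemma Ftilde_shift (p w : 'rV[R]_2) : Ftilde S x (w + p) =
  Ftilde S x p + w 0 0 *: Ftilde_psi (p 0 1) + w 0 1 *: Ftilde_phi (p 0 0)
  + (w 0 0 * w 0 1) *: Ftilde_mix.
Proof.
apply/rowP => j; rewrite /Ftilde /Ftilde_psi /Ftilde_phi /Ftilde_mix.
by rewrite !mxE; field.
Qed.

Lemma Ftilde_psi_shift (v k : R) :
  Ftilde_psi (k + v) = Ftilde_psi v + k *: Ftilde_mix.
Proof. by apply/rowP => j; rewrite !mxE; field. Qed.

Lemma Ftilde_phi_shift (u h : R) :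
  Ftilde_phi (h + u) = Ftilde_phi u + h *: Ftilde_mix.
Proof. by apply/rowP => j; rewrite !mxE; field. Qed.

Lemma differentiable_Ftilde (p : 'rV[R]_2) : differentiable (Ftilde S x) p.
Proof.
have -> : Ftilde S x = fun w => Ftilde S x 0 + w 0 0 *: Ftilde_psi 0
    + w 0 1 *: Ftilde_phi 0 + (w 0 0 * w 0 1) *: Ftilde_mix.
  by apply/funext => w; rewrite -{1}[w]addr0 Ftilde_shift !mxE.
have coord j : differentiable (fun w : 'rV[R]_2 => w 0 j) p.
  exact: differentiable_coord.
apply: differentiableD; last first.
  by apply: differentiableZl; apply: differentiableM.
apply: differentiableD; last exact: differentiableZl.
by apply: differentiableD; last exact: differentiableZl.
Qed.

Lemma jacobian_Ftilde (p : 'rV[R]_2) (i : 'I_2) :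
  row i (jacobian (Ftilde S x) p) =
  if i == 0 then Ftilde_psi (p 0 1) else Ftilde_phi (p 0 0).
Proof.
rewrite rowE -deriveEjacobian; last exact: differentiable_Ftilde.
(* Along a coordinate direction the mixed term vanishes, so the difference quotient is constant for
   [h != 0]. *)
rewrite /derive; apply: lim_near_cst => //; near=> h.
have h0 : h != 0 by near: h; exact: nbhs_dnbhs_neq.
rewrite /= Ftilde_shift !mxE.
by case: (ord2_cases i) => ->; rewrite !(mulr0, mul0r, scale0r, addr0, mulr1) /=;
  rewrite addrC addKr scalerA mulVf // scale1r.
Unshelve. all: by end_near. Qed.

Definition Ftilde_det (p : 'rV[R]_2) : R :=
  Ftilde_psi (p 0 1) 0 0 * Ftilde_phi (p 0 0) 0 1
  - Ftilde_phi (p 0 0) 0 0 * Ftilde_psi (p 0 1) 0 1.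

Lemma det_layer_jacobian (psi phi : R -> R) (p : 'rV[R]_2) :
  \det (layer_jacobian S psi phi x p) = Ftilde_det p
  * (derive1 psi (reg_inv psi (p 0 0)) * derive1 phi (reg_inv phi (p 0 1))).
Proof.
have J i j : jacobian (Ftilde S x) p i j =
    (if i == 0 then Ftilde_psi (p 0 1) else Ftilde_phi (p 0 0)) 0 j.
  by rewrite -jacobian_Ftilde [RHS]mxE.
rewrite det_mulmx det_tr det_diag big_ord_recl big_ord1 det_mx22 !J.
by rewrite /Ftilde_det [Ftilde_phi _ 0 0 * _]mulrC !mxE.
Qed.

(** Centring at the zero [p] removes the constant term and leaves the bilinear pair studied
    above. *)
Lemma Ftilde_shift_eq0 (p w : 'rV[R]_2) : Ftilde S x p = 0 ->
  Ftilde S x (w + p) = 0 <->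
  Ftilde_psi (p 0 1) 0 0 * w 0 0 + Ftilde_phi (p 0 0) 0 0 * w 0 1
    + Ftilde_mix 0 0 * w 0 0 * w 0 1 = 0 /\
  Ftilde_psi (p 0 1) 0 1 * w 0 0 + Ftilde_phi (p 0 0) 0 1 * w 0 1
    + Ftilde_mix 0 1 * w 0 0 * w 0 1 = 0.
Proof.
move=> p0; rewrite Ftilde_shift p0 add0r.
have entry j : (w 0 0 *: Ftilde_psi (p 0 1) + w 0 1 *: Ftilde_phi (p 0 0)
      + (w 0 0 * w 0 1) *: Ftilde_mix) 0 j =
    Ftilde_psi (p 0 1) 0 j * w 0 0 + Ftilde_phi (p 0 0) 0 j * w 0 1
      + Ftilde_mix 0 j * w 0 0 * w 0 1.
  by rewrite !mxE; ring.
rewrite -!entry; split=> [->|[E0 E1]]; first by rewrite !mxE.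
by apply/rowP => j; rewrite [RHS]mxE; case: (ord2_cases j) => ->.
Qed.

(** * Determinants of the differential at the two zeros *)

Lemma rV2_sub_neq0 (p q : 'rV[R]_2) : p <> q ->
  ((q - p) 0 0 != 0) || ((q - p) 0 1 != 0).
Proof.
move=> pq; rewrite -negb_and !mxE !subr_eq0; apply/negP => /andP[/eqP E0 /eqP E1].
by apply: pq; apply/rowP => j; case: (ord2_cases j) => ->.
Qed.

Lemma Ftilde_det_opp (p q : 'rV[R]_2) : p <> q ->
  Ftilde S x p = 0 -> Ftilde S x q = 0 -> Ftilde_det q = - Ftilde_det p.
Proof.
move=> pq p0 q0; rewrite /Ftilde_det.
have [E0 E1] : _ /\ _ := (Ftilde_shift_eq0 p (q - p) p0).1
  (etrans (congr1 _ (subrK p q)) q0).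
rewrite -(bilinear_det_opp _ _ _ _ _ _ _ _ _ (rV2_sub_neq0 _ _ pq) E0 E1).
have shift j : q 0 j = (q - p) 0 j + p 0 j by rewrite !mxE subrK.
rewrite !(shift 0) !(shift 1) Ftilde_psi_shift Ftilde_phi_shift.
have E (A B : 'rV[R]_2) (a : R) j : (A + a *: B) 0 j = A 0 j + B 0 j * a.
  by rewrite !mxE mulrC.
by rewrite !E.
Qed.

Lemma Ftilde_det_neq0 (p q : 'rV[R]_2) :
  sliding_pair S x p q -> Ftilde_det p != 0.
Proof.
move=> [pq zeros]; apply/eqP => /subr0_eq det0.
have [/andP[u_gt u_lt] [/andP[v_gt v_lt] p0]] : sliding_zeros S x p.
  by rewrite zeros; left.
have [_ [_ q0]] : sliding_zeros S x q by rewrite zeros; right.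
have [E0 E1] : _ /\ _ := (Ftilde_shift_eq0 p (q - p) p0).1
  (etrans (congr1 _ (subrK p q)) q0).
(* [e] is the distance from [p] to the nearest side of the square, so the new zero stays inside. *)
have [e [e0 el er ed eu]] : exists e, [/\ 0 < e, e <= p 0 0 + 1, e <= 1 - p 0 0,
    e <= p 0 1 + 1 & e <= 1 - p 0 1].
  exists (Num.min (Num.min (p 0 0 + 1) (1 - p 0 0))
                  (Num.min (p 0 1 + 1) (1 - p 0 1))).
  by rewrite !lt_min !ge_min !lexx !orbT; split=> //;
    rewrite -!andbA; apply/and4P; split; lra.
have [s [r [/ltr_normlP[s1 s2] /ltr_normlP[r1 r2] n0 nh E]]] :=
  bilinear_zero_near0 _ _ _ _ _ _ _ _ _ _ e0 (rV2_sub_neq0 _ _ pq) det0 E0 E1.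
have wE : row2 s r 0 0 = s /\ row2 s r 0 1 = r by rewrite !mxE.
have : sliding_zeros S x (row2 s r + p).
  split; last split.
  - by rewrite mxE wE.1; apply/andP; split; lra.
  - by rewrite mxE wE.2; apply/andP; split; lra.
  - by apply/(Ftilde_shift_eq0 _ _ p0); rewrite wE.1 wE.2.
(* The new zero is not [p] since [(s, r)] is nonzero, and not [q] since [(s, r)] differs from
   [q - p]. *)
rewrite zeros => -[] /= /(canRL (addrK p)) wp.
- by case/orP: n0 => /eqP[]; [rewrite -wE.1|rewrite -wE.2]; rewrite wp subrr mxE.
- by case/orP: nh => /eqP[]; [rewrite -wE.1|rewrite -wE.2]; rewrite wp.
Qed.

End FtildeExpansion.

Theorem proposition10 (R : realType) (S : pws_system R) (psi phi : R -> R)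
    (hpsi : regularization psi) (hphi : regularization phi)
    (x : R) (hx : pws_itv S x) (p q : 'rV[R]_2) (hpq : sliding_pair S x p q) :
  (saddle_type S psi phi x p /\ node_focus_type S psi phi x q) \/
  (node_focus_type S psi phi x p /\ saddle_type S psi phi x q).
Proof.
have [pq zeros] := hpq.
have [pu [pv p0]] : sliding_zeros S x p by rewrite zeros; left.
have [qu [qv q0]] : sliding_zeros S x q by rewrite zeros; right.
rewrite /saddle_type /node_focus_type !det_layer_jacobian.
(* The positive slopes of [psi] and [phi] drop out, leaving the sign of [Ftilde_det]. *)
rewrite !(pmulr_llt0, pmulr_lgt0) ?mulr_gt0 ?derive_reg_inv_gt0 //.
rewrite (Ftilde_det_opp _ _ _ _ _ pq p0 q0) oppr_gt0 oppr_lt0.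
by have := Ftilde_det_neq0 _ _ _ _ _ hpq; rewrite neq_lt => /orP[]; [left|right].
Qed.
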